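(* Let $M$ be a complete pointed metric space. The following assertions are equivalent: (i) $M$ is a length space. (ii) $\mathrm{Lip}_0(M)$ has the Daugavet property. (iii) $\mathcal F(M)$ has the Daugavet property.
   Context: All Banach spaces are real. A pointed metric space is a metric space $(M,d)$ with a distinguished point $0\in M$. $\mathrm{Lip}_0(M)$ is the Banach space of all Lipschitz functions $f\colon M\to\mathbb R$ with $f(0)=0$, normed by the Lipschitz constant $\|f\|_L=\sup\{|f(x)-f(y)|/d(x,y): x\neq y\in M\}$. The Lipschitz free space is $\mathcal F(M)=\overline{\mathrm{span}}\{\delta_x:x\in M\}\subset \mathrm{Lip}_0(M)^*$, where $\delta_x(f)=f(x)$; it is a predual of $\mathrm{Lip}_0(M)$, i.e. $\mathcal F(M)^*=\mathrm{Lip}_0(M)$ isometrically. A metric space $M$ is a length space if for every $x,y\in M$ the distance $d(x,y)$ equals the infimum of the lengths of rectifiable curves in $M$ joining $x$ and $y$. A Banach space $X$ has the Daugavet property if every bounded rank-one operator $T\colon X\to X$ satisfies $\|T+I\|=1+\|T\|$, where $I$ is the identity operator. *)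

(* Defs.v *)
From HB Require Import structures.
From mathcomp Require Import all_boot all_order all_algebra.
From mathcomp Require Import all_classical all_reals all_analysis.

Set Implicit Arguments.
Unset Strict Implicit.
Unset Printing Implicit Defensive.

Import Order.TTheory GRing.Theory Num.Theory.
Import numFieldNormedType.Exports.

Local Open Scope classical_set_scope.
Local Open Scope ring_scope.

(* The distinguished point of M is [point : M]. *)

#[short(type="pointedMetricType")]
HB.structure Definition PointedMetric (R : numDomainType) :=
  {M of Metric R M & Pointed M}.

#[short(type="completeMetricType")]
HB.structure Definition CompleteMetric (R : numDomainType) :=
  {M of Metric R M & Complete M}.

Section length_space.
Context {R : realType} (M : metricType R).
Implicit Types (g : R -> M) (s : seq R) (x y : M).

(* Metric-valued counterpart of [variation]: the partition a < s_0 < ... is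
   given by the list s of its points other than a. *)
Definition polygonal_length (a b : R) g s : R :=
  let G := g \o nth b (a :: s) in
  \sum_(0 <= n < size s) mdist (G n) (G n.+1).

Definition curve_length g : \bar R :=
  ereal_sup [set (polygonal_length 0 1 g s)%:E | s in itv_partition 0 1].

Definition rectifiable g := (curve_length g < +oo)%E.

(* Curves are parametrised by [0, 1]; the values of g elsewhere are
   irrelevant. *)
Definition joining_curve x y g :=
  [/\ {within `[0, 1], continuous g}, g 0 = x & g 1 = y].

(* The infimum of the empty set is +oo, so points that no rectifiable curve
   joins violate the condition. *)
Definition length_space := forall x y : M,
  (mdist x y)%:E =
  ereal_inf [set curve_length g | g in [set g | joining_curve x y g
                                              /\ rectifiable g]].

End length_space.

Section bounded_operator.
Context {R : realType} (X Y : normedModType R).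

Definition bounded_linear : {pred X -> Y} :=
  mem [set f : X -> Y | linear f /\ exists k, forall x, `|f x| <= k * `|x|].

Record boundedOp := BoundedOp {
  bop_fun :> X -> Y ;
  bop_funP : bop_fun \in bounded_linear }.

HB.instance Definition _ := [isSub for bop_fun].
HB.instance Definition _ := [Choice of boundedOp by <:].

Lemma bop_linear (f : boundedOp) : linear f.
Proof. by have := bop_funP f; rewrite inE => -[]. Qed.

Lemma bop_bounded (f : boundedOp) : exists k, forall x, `|f x| <= k * `|x|.
Proof. by have := bop_funP f; rewrite inE => -[]. Qed.

HB.instance Definition _ (f : boundedOp) :=
  GRing.isLinear.Build R X Y *:%R (bop_fun f) (bop_linear f).

Lemma bounded_linear_submod : submod_closed bounded_linear.
Proof.
split.
  rewrite inE; split; first by move=> a u v /=; rewrite scaler0 addr0.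
  by exists 0 => x; rewrite normr0 mul0r.
move=> a f g; rewrite !inE => -[lf [k fk]] [lg [l gl]]; split.
  move=> b u v.
  change (a *: f (b *: u + v) + g (b *: u + v) =
    b *: (a *: f u + g u) + (a *: f v + g v)).
  by rewrite lf lg !scalerDr !scalerA (mulrC b a) addrACA.
exists (`|a| * k + l) => x.
change (`|a *: f x + g x| <= (`|a| * k + l) * `|x|).
rewrite (le_trans (ler_normD _ _))// normrZ mulrDl lerD// -mulrA.
by rewrite ler_wpM2l.
Qed.

HB.instance Definition _ :=
  GRing.isSubmodClosed.Build _ _ bounded_linear bounded_linear_submod.
HB.instance Definition _ := [SubChoice_isSubLmodule of boundedOp by <:].

Lemma bopDE (f g : boundedOp) x : (f + g) x = f x + g x. Proof. by []. Qed.

Lemma bopZE a (f : boundedOp) x : (a *: f) x = a *: f x. Proof. by []. Qed.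

Definition op_norm (f : boundedOp) : R :=
  sup [set `|f x| | x in [set x : X | `|x| <= 1]].

Lemma op_norm_has_sup (f : boundedOp) :
  has_sup [set `|f x| | x in [set x : X | `|x| <= 1]].
Proof.
split; first by exists `|f 0|, 0 => //=; rewrite normr0.
have [k fk] := bop_bounded f; exists `|k| => _ [x /= x1 <-].
rewrite (le_trans (fk x))// (le_trans (ler_wpM2r _ (ler_norm k)))//.
by rewrite ler_piMr.
Qed.

Lemma op_norm_ge0 (f : boundedOp) : 0 <= op_norm f.
Proof.
rewrite -(normr0 Y) -(linear0 f); apply: (ub_le_sup (op_norm_has_sup f).2).
by exists 0 => //=; rewrite normr0.
Qed.

Lemma op_norm_ub (f : boundedOp) x : `|f x| <= op_norm f * `|x|.
Proof.
have [->|x0] := eqVneq x 0; first by rewrite linear0 !normr0 mulr0.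
have nx0 : 0 < `|x| by rewrite normr_gt0.
have : `|f (`|x|^-1 *: x)| <= op_norm f.
  apply: (ub_le_sup (op_norm_has_sup f).2); exists (`|x|^-1 *: x) => //=.
  by rewrite normrZ normfV normr_id mulVf// gt_eqF.
by rewrite linearZ normrZ normfV normr_id ler_pdivrMl// mulrC.
Qed.

Lemma op_norm_le (f : boundedOp) k :
  0 <= k -> (forall x, `|f x| <= k * `|x|) -> op_norm f <= k.
Proof.
move=> k0 fk; apply: (ge_sup (op_norm_has_sup f).1) => _ [x /= x1 <-].
by rewrite (le_trans (fk x))// ler_piMr.
Qed.

Lemma op_normD f g : op_norm (f + g) <= op_norm f + op_norm g.
Proof.
apply: op_norm_le; first by rewrite addr_ge0 ?op_norm_ge0.
move=> x; rewrite bopDE (le_trans (ler_normD _ _))// mulrDl.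
by rewrite lerD ?op_norm_ub.
Qed.

Let op_normZ_le a f : op_norm (a *: f) <= `|a| * op_norm f.
Proof.
apply: op_norm_le; first by rewrite mulr_ge0 ?op_norm_ge0.
by move=> x; rewrite bopZE normrZ -mulrA ler_wpM2l ?op_norm_ub.
Qed.

Lemma op_normZ a f : op_norm (a *: f) = `|a| * op_norm f.
Proof.
apply/eqP; rewrite eq_le op_normZ_le/=.
have [->|a0] := eqVneq a 0; first by rewrite normr0 mul0r op_norm_ge0.
have := op_normZ_le a^-1 (a *: f).
by rewrite scalerA mulVf// scale1r normfV ler_pdivlMl ?normr_gt0.
Qed.

Lemma op_norm_eq0 f : op_norm f = 0 -> f = 0.
Proof.
move=> f0; apply/val_inj/funext => x; apply/eqP.
by rewrite -normr_le0 (le_trans (op_norm_ub f x))// f0 mul0r.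
Qed.

HB.instance Definition _ :=
  Lmodule_isNormed.Build R boundedOp op_normD op_normZ op_norm_eq0.

End bounded_operator.

Arguments bounded_linear {R} X Y _.

Definition dual {R : realType} (X : normedModType R) : normedModType R :=
  boundedOp X R^o.

Section daugavet.
Context {R : realType} (X : normedModType R).

Lemma id_bounded_linear : (id : X -> X) \in bounded_linear X X.
Proof. by rewrite inE; split => //; exists 1 => x; rewrite mul1r. Qed.

Definition id_op : boundedOp X X := BoundedOp id_bounded_linear.

Definition rank_one (T : boundedOp X X) :=
  exists2 y : X, y != 0 & range T = [set a *: y | a in [set: R]].

Definition daugavet_property :=
  forall T : boundedOp X X, rank_one T -> `|T + id_op| = 1 + `|T|.

End daugavet.

Section closed_span.
Context {R : realType} (V : normedModType R) (A : set V).

Definition linear_span : set V :=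
  [set v | exists n (a : 'I_n -> R) (u : 'I_n -> V),
     (forall i, A (u i)) /\ v = \sum_i a i *: u i].

Definition in_closed_span : {pred V} := mem (closure linear_span).

Record closedSpan := ClosedSpan {
  cspan_val : V ;
  cspan_valP : cspan_val \in in_closed_span }.

HB.instance Definition _ := [isSub for cspan_val].
HB.instance Definition _ := [Choice of closedSpan by <:].

Lemma linear_span0 : linear_span 0.
Proof.
exists 0%N, (fun=> 0), (fun=> 0); split; first by case.
by rewrite big_ord0.
Qed.

Lemma linear_spanP a u v :
  linear_span u -> linear_span v -> linear_span (a *: u + v).
Proof.
move=> [m [b [x [Ax ->]]]] [n [c [y [Ay ->]]]].
exists (m + n)%N,
  (fun i => match fintype.split i with inl j => a * b j | inr j => c j end),
  (fun i => match fintype.split i with inl j => x j | inr j => y j end).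
split; first by move=> i; case: fintype.split.
rewrite big_split_ord scaler_sumr/=; congr (_ + _); apply: eq_bigr => i _.
  by rewrite (unsplitK (inl i)) scalerA.
by rewrite (unsplitK (inr i)).
Qed.

Lemma in_closed_span_submod : submod_closed in_closed_span.
Proof.
split; first by rewrite inE; exact/subset_closure/linear_span0.
move=> a u v; rewrite !inE => clu clv B nB.
have cont : a *: z.1 + z.2 @[z --> (u, v)] --> a *: u + v.
  by apply: cvgD; [apply: cvgZr; exact: cvg_fst|exact: cvg_snd].
have [[P Q] /= [nP nQ] PQ] := cont _ nB.
have [p [sp Pp]] := clu _ nP; have [q [sq Qq]] := clv _ nQ.
exists (a *: p + q); split; first exact: linear_spanP.
by apply: (PQ (p, q)).
Qed.

HB.instance Definition _ :=
  GRing.isSubmodClosed.Build _ _ in_closed_span in_closed_span_submod.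
HB.instance Definition _ := [SubChoice_isSubLmodule of closedSpan by <:].

Definition cspan_norm (u : closedSpan) : R := `|cspan_val u|.

Lemma cspan_normD u v : cspan_norm (u + v) <= cspan_norm u + cspan_norm v.
Proof. exact: ler_normD. Qed.

Lemma cspan_normZ a u : cspan_norm (a *: u) = `|a| * cspan_norm u.
Proof. exact: normrZ. Qed.

Lemma cspan_norm_eq0 u : cspan_norm u = 0 -> u = 0.
Proof. by move=> /normr0_eq0 u0; exact/val_inj. Qed.

HB.instance Definition _ :=
  Lmodule_isNormed.Build R closedSpan cspan_normD cspan_normZ cspan_norm_eq0.

End closed_span.

Section lip0.
Context {R : realType} (M : pointedMetricType R).

Definition lipschitz0 : {pred M -> R^o} :=
  mem [set f : M -> R^o | f point = 0 /\
    exists k, forall x y, `|f x - f y| <= k * mdist x y].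

Record lip0 := Lip0 {
  lip0_fun :> M -> R^o ;
  lip0_funP : lip0_fun \in lipschitz0 }.

HB.instance Definition _ := [isSub for lip0_fun].
HB.instance Definition _ := [Choice of lip0 by <:].

Lemma lip0_point (f : lip0) : f point = 0.
Proof. by have := lip0_funP f; rewrite inE => -[]. Qed.

Lemma lip0_lipschitz (f : lip0) :
  exists k, forall x y, `|f x - f y| <= k * mdist x y.
Proof. by have := lip0_funP f; rewrite inE => -[]. Qed.

Lemma lipschitz0_submod : submod_closed lipschitz0.
Proof.
split.
  rewrite inE; split => //; exists 0 => x y.
  by rewrite subrr normr0 mul0r.
move=> a f g; rewrite !inE => -[f0 [k fk]] [g0 [l gl]]; split.
  change (a *: f point + g point = 0).
  by rewrite f0 g0 scaler0 addr0.
exists (`|a| * k + l) => x y.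
change (`|a *: f x + g x - (a *: f y + g y)| <= (`|a| * k + l) * mdist x y).
rewrite opprD addrACA -scalerBr (le_trans (ler_normD _ _))// normrZ mulrDl.
by rewrite lerD// -mulrA ler_wpM2l.
Qed.

HB.instance Definition _ :=
  GRing.isSubmodClosed.Build _ _ lipschitz0 lipschitz0_submod.
HB.instance Definition _ := [SubChoice_isSubLmodule of lip0 by <:].

Lemma lip0DE (f g : lip0) x : (f + g) x = f x + g x. Proof. by []. Qed.

Lemma lip0ZE a (f : lip0) x : (a *: f) x = a *: f x. Proof. by []. Qed.

(* If M is a singleton, the supremum is over the empty set, and is 0. *)
Definition lip_norm (f : lip0) : R :=
  sup [set `|f xy.1 - f xy.2| / mdist xy.1 xy.2
      | xy in [set xy : M * M | xy.1 != xy.2]].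

Lemma lip_norm_le (f : lip0) k : 0 <= k ->
  (forall x y, `|f x - f y| <= k * mdist x y) -> lip_norm f <= k.
Proof.
move=> k0 fk; rewrite /lip_norm; set S := (X in sup X).
have [->|/set0P S0] := eqVneq S set0; first by rewrite sup0.
apply: (ge_sup S0) => _ [[x y]/= xy <-].
by rewrite ler_pdivrMr// mdist_gt0.
Qed.

Lemma lip_norm_ub (f : lip0) x y : `|f x - f y| <= lip_norm f * mdist x y.
Proof.
have [->|xy] := eqVneq x y; first by rewrite subrr normr0 mdistxx mulr0.
rewrite -ler_pdivrMr ?mdist_gt0//; apply: ub_le_sup; last by exists (x, y).
have [k fk] := lip0_lipschitz f; exists k => _ [[u v]/= uv <-].
by rewrite ler_pdivrMr ?mdist_gt0.
Qed.

Lemma lip_norm_ge0 (f : lip0) : 0 <= lip_norm f.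
Proof.
rewrite /lip_norm; set S := (X in sup X).
have [->|/set0P [_ [[x y]/= xy _]]] := eqVneq S set0; first by rewrite sup0.
have := le_trans (normr_ge0 _) (lip_norm_ub f x y).
by rewrite pmulr_lge0 ?mdist_gt0.
Qed.

Lemma lip_normD f g : lip_norm (f + g) <= lip_norm f + lip_norm g.
Proof.
apply: lip_norm_le; first by rewrite addr_ge0 ?lip_norm_ge0.
move=> x y; rewrite !lip0DE opprD addrACA (le_trans (ler_normD _ _))// mulrDl.
by rewrite lerD ?lip_norm_ub.
Qed.

Let lip_normZ_le a f : lip_norm (a *: f) <= `|a| * lip_norm f.
Proof.
apply: lip_norm_le; first by rewrite mulr_ge0 ?lip_norm_ge0.
by move=> x y; rewrite !lip0ZE -scalerBr normrZ -mulrA ler_wpM2l ?lip_norm_ub.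
Qed.

Lemma lip_normZ a f : lip_norm (a *: f) = `|a| * lip_norm f.
Proof.
apply/eqP; rewrite eq_le lip_normZ_le/=.
have [->|a0] := eqVneq a 0; first by rewrite normr0 mul0r lip_norm_ge0.
have := lip_normZ_le a^-1 (a *: f).
by rewrite scalerA mulVf// scale1r normfV ler_pdivlMl ?normr_gt0.
Qed.

Lemma lip_norm_eq0 f : lip_norm f = 0 -> f = 0.
Proof.
move=> f0; apply/val_inj/funext => x; apply/eqP.
rewrite -normr_le0; have := lip_norm_ub f x point.
by rewrite f0 mul0r lip0_point subr0.
Qed.

HB.instance Definition _ :=
  Lmodule_isNormed.Build R lip0 lip_normD lip_normZ lip_norm_eq0.

Lemma eval_bounded_linear (x : M) :
  (fun f : lip0 => f x) \in bounded_linear lip0 R^o.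
Proof.
rewrite inE; split => //; exists (mdist x point) => f.
rewrite mulrC; have := lip_norm_ub f x point.
by rewrite lip0_point subr0.
Qed.

Definition delta (x : M) : dual lip0 := BoundedOp (eval_bounded_linear x).

Definition free_space : normedModType R := closedSpan (range delta).

End lip0.

(* Main.v *)
Require Import Defs.
From mathcomp Require Import all_boot all_order all_algebra.
From mathcomp Require Import all_classical all_reals all_analysis.
From mathcomp Require Import ring lra.

(* A rank-one operator is rigid enough that all arguments are about pairs of
   points at which Lipschitz functions have almost maximal slope.

   Length space => Lip_0(M): let f0 almost attain the norm of T and g = T f0.
   In a length space g has almost maximal slope on n arbitrarily close pairs
   (p_k, q_k) lying in disjoint balls. Near q_k one can change f0 by h_k, with
   f0 + h_k of norm at most 1 + e and of slope 1 at (p_k, q_k). Since the h_k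
   have disjoint supports, sum_k |T h_k| is bounded independently of n, so some
   T h_k is small, and (T + I)(f0 + h_k) has slope about 1 + |T| at (p_k, q_k).

   Lip_0(M) => F(M): an operator on F(M) and its adjoint have the same norm.

   F(M) => length space: if x and y have no approximate midpoint, the difference
   f of two small bumps around x and y has large slope only at pairs (u, v) with
   u near x and v near y, at a definite distance of each other. The Daugavet
   equation for mu |-> mu(f) (delta_y - delta_x) / d(x, y) gives a 1-Lipschitz
   function g with slope almost 1 at both (y, x) and such a (u, v), and the two
   increments add up to too much. Completeness turns approximate midpoints into
   Lipschitz curves. *)

Set Implicit Arguments.
Unset Strict Implicit.
Unset Printing Implicit Defensive.

Import Order.TTheory GRing.Theory Num.Theory.
Import numFieldNormedType.Exports.

Local Open Scope classical_set_scope.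
Local Open Scope ring_scope.

(** * Length spaces and approximate midpoints *)

(** Quantifying over every [s] above half the distance means that failure yields one fixed [s], with
    a definite gap [s - mdist x y / 2]. *)
Definition approx_midpoints (R : realType) (M : metricType R) :=
  forall (x y : M) (s : R), mdist x y < s *+ 2 ->
  exists z, mdist x z <= s /\ mdist z y <= s.

Lemma le_of_half_pow (R : realType) (a b c : R) :
  (forall n, a <= b + c / 2 ^+ n) -> a <= b.
Proof.
move=> h; apply/ler_addgt0Pl => e e0.
have [c0|c0] := leP c 0.
  by have := h 0%N; rewrite expr0 divr1; lra.
pose n := Num.truncn (c / e).
apply: (le_trans (h n)); rewrite addrC lerD2r.
rewrite ler_pdivrMr ?exprn_gt0// mulrC -ler_pdivrMr//.
apply: (le_trans (ltW (truncnS_gt _))).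
by rewrite -natrX ler_nat ltn_expl.
Qed.

Lemma geometric_cauchy_cvg (R : realType) (M : completeMetricType R)
    (u : nat -> M) (L : R) :
  (forall n, mdist (u n) (u n.+1) <= L / 2 ^+ n.+1) ->
  exists l, forall n, mdist (u n) l <= L / 2 ^+ n.
Proof.
move=> uL.
have L0 : 0 <= L.
  have := le_trans (mdist_ge0 _ _) (uL 0%N).
  by rewrite pmulr_lge0// invr_gt0 exprn_gt0.
have P0 n : 0 < (2 ^+ n : R) by rewrite exprn_gt0.
have uLk n k : mdist (u n) (u (n + k)%N) <= L / 2 ^+ n - L / 2 ^+ (n + k).
  elim: k => [|k ih]; first by rewrite addn0 mdistxx subrr.
  rewrite addnS (le_trans (metric_triangle _ (u (n + k)%N) _))//.
  have := uL (n + k)%N; move: ih; rewrite exprS invfM.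
  set a := (2 ^+ (n + k))^-1; lra.
have uLk' n k : mdist (u n) (u (n + k)%N) <= L / 2 ^+ n.
  by rewrite (le_trans (uLk n k))// gerBl divr_ge0// ltW.
have cu : cauchy (u @ \oo).
  apply: cauchy_exP => e e0.
  pose n := Num.truncn (L / e).
  exists (u n); exists n => // m /= nm.
  rewrite -(subnKC nm) ballEmdist/= (le_lt_trans (uLk' _ _))//.
  rewrite ltr_pdivrMr// mulrC -ltr_pdivrMr//.
  apply: (lt_le_trans (truncnS_gt _)).
  by rewrite -natrX ler_nat ltn_expl.
move/cauchy_cvgP : cu => cu; exists (lim (u @ \oo)) => n.
apply/ler_addgt0Pr => e e0.
have [N _ Nu] := metricType_numDomainType.cvgr_dist_lt cu e0.
rewrite (le_trans (metric_triangle _ (u (n + N)%N) _))// lerD//.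
by rewrite metric_sym ltW// Nu//= leq_addl.
Qed.

(** * Dyadic subdivision by approximate midpoints *)

Section dyadic_points.
Context {R : realType} (M : metricType R).
Variables (mid : nat -> M -> M -> M) (x y : M).

(** The intended value of a curve at k / 2^n: even indices repeat the previous level, odd ones
    insert midpoints. Level 0 is [y] at every positive index, so the step bounds below hold for all
    [k], with no upper limit 2^n. *)
Fixpoint dyadic_point n k : M :=
  if n is n'.+1 then
    if odd k then mid n' (dyadic_point n' k./2) (dyadic_point n' k./2.+1)
    else dyadic_point n' k./2
  else if k is 0 then x else y.

Lemma dyadic_point0 n : dyadic_point n 0 = x.
Proof. by elim: n. Qed.

Lemma dyadic_point_last n : dyadic_point n (2 ^ n) = y.
Proof. by elim: n => //= n; rewrite expnS mul2n odd_double doubleK. Qed.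

Variable s : nat -> R.
Hypothesis s0 : mdist x y <= s 0.
Hypothesis s_ge0 : forall n, 0 <= s n.
Hypothesis midP : forall n a b, mdist a b <= s n ->
  mdist a (mid n a b) <= s n.+1 /\ mdist (mid n a b) b <= s n.+1.

Lemma dyadic_point_step n k :
  mdist (dyadic_point n k) (dyadic_point n k.+1) <= s n.
Proof.
elim: n k => [[|k]//=|n ih k]; first by rewrite mdistxx s_ge0.
rewrite /= uphalf_half; have [ko|ke] := boolP (odd k) => /=.
  by rewrite add1n; exact: (midP (ih _)).2.
by rewrite add0n; exact: (midP (ih _)).1.
Qed.

Lemma dyadic_point_lipschitz n j k :
  mdist (dyadic_point n j) (dyadic_point n (j + k)) <= k%:R * s n.
Proof.
elim: k => [|k ih]; first by rewrite addn0 mdistxx mul0r.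
rewrite addnS (le_trans (metric_triangle _ (dyadic_point n (j + k)) _))//.
by rewrite -natr1 mulrDl mul1r lerD ?dyadic_point_step.
Qed.

Lemma dyadic_point_refine n k :
  mdist (dyadic_point n k./2) (dyadic_point n.+1 k) <= s n.+1.
Proof.
rewrite /=; case: ifP => _; last by rewrite mdistxx.
by have [] := midP (dyadic_point_step n k./2).
Qed.

End dyadic_points.

(** Applied to u = 2^n t, this makes the level [n] index of [t] the half of its level [n.+1] index,
    the form that [dyadic_point_refine] expects. *)
Lemma truncn_half (R : realType) (u : R) : 0 <= u ->
  (Num.truncn (2 * u))./2 = Num.truncn u.
Proof.
move=> u0; apply/esym/truncn_def.
have /truncn_itv : 0 <= 2 * u by rewrite mulr_ge0.
set m := Num.truncn _ => /andP[m1 m2].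
have E : m%:R = (odd m)%:R + 2 * (m./2)%:R :> R.
  by rewrite -natrM -natrD mul2n odd_double_half.
move: m1 m2; rewrite -!natr1 E.
by case: (odd m) => /=; rewrite ?mulr0n ?mulr1n => *; apply/andP; split; lra.
Qed.

(** The value at [t] is the limit of the dyadic points of index floor(2^n t), which exists by
    completeness. The Lipschitz estimate between dyadic points of level [n] passes to the limit. *)
Lemma approx_midpoints_lipschitz_curve (R : realType)
    (M : completeMetricType R) (x y : M) (e : R) :
  approx_midpoints M -> 0 < e ->
  exists g : R -> M, [/\ g 0 = x, g 1 = y &
   forall s t, 0 <= s -> s <= t ->
     mdist (g s) (g t) <= (mdist x y + e) * (t - s)].
Proof.
move=> AM e0; set d := mdist x y; set L := d + e.
have d0 : 0 <= d := mdist_ge0 _ _.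
have P0 n : 0 < (2 ^+ n : R) by rewrite exprn_gt0.
(* The slack e (1 - 2^-n) increases with n, which leaves room for an
   approximate midpoint at each stage: s n < 2 s (n + 1). *)
pose s n : R := (d + e * (1 - (2 ^+ n)^-1)) / 2 ^+ n.
have PV1 n : (2 ^+ n : R)^-1 <= 1.
  by rewrite invf_le1 ?posrE// exprn_ege1// ler1n.
have s_ge0 n : 0 <= s n.
  by rewrite divr_ge0 ?(ltW (P0 n))// addr_ge0// mulr_ge0 ?(ltW e0)// subr_ge0.
have s_le n : s n <= L / 2 ^+ n.
  by rewrite ler_pM2r ?invr_gt0// lerD2l ler_piMr ?(ltW e0)// gerBl.
have s_half n : s n < s n.+1 *+ 2.
  rewrite /s exprS invfM.
  have a0 : 0 < (2 ^+ n : R)^-1 by rewrite invr_gt0.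
  set a := _^-1 in a0 *; rewrite -subr_gt0.
  rewrite (_ : _ - _ = e * a * a / 2); first by rewrite !mulr_gt0.
  by rewrite mulr2n; field.
have /choice[mid0 mid0P] : forall nab : nat * (M * M), exists z,
    mdist nab.2.1 nab.2.2 <= s nab.1 ->
    mdist nab.2.1 z <= s nab.1.+1 /\ mdist z nab.2.2 <= s nab.1.+1.
  move=> [n [a b]] /=; have [ab|ab] := leP (mdist a b) (s n); last by exists a.
  by have [z zP] := AM a b _ (le_lt_trans ab (s_half n)); exists z.
pose mid n a b := mid0 (n, (a, b)).
have midP n a b : mdist a b <= s n ->
    mdist a (mid n a b) <= s n.+1 /\ mdist (mid n a b) b <= s n.+1.
  exact: (mid0P (n, (a, b))).
have s0 : mdist x y <= s 0.
  by rewrite /s expr0 invr1 subrr mulr0 addr0 mulr1.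
pose D := dyadic_point mid x y.
pose u (t : R) n := D n (Num.truncn (2 ^+ n * t)).
have uL (t : R) n : 0 <= t -> mdist (u t n) (u t n.+1) <= L / 2 ^+ n.+1.
  move=> t0; apply: (le_trans _ (s_le _)).
  rewrite /u exprS -mulrA -truncn_half; last by rewrite mulr_ge0// ltW.
  exact: (dyadic_point_refine s0 s_ge0 midP).
have /choice[g gP] : forall t : R, exists l, 0 <= t ->
    forall n, mdist (u t n) l <= L / 2 ^+ n.
  move=> t; have [t0|t0] := leP 0 t; last by exists x.
  by have [l lP] := geometric_cauchy_cvg (fun n => uL t n t0); exists l.
exists g; split.
- apply/esym/mdist_positivity/eqP; rewrite eq_le mdist_ge0 andbT.
  apply: (@le_of_half_pow _ _ _ L) => n; rewrite add0r.
  have := gP 0 (lexx _) n.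
  by rewrite /u mulr0 truncn0 /D dyadic_point0.
- apply/esym/mdist_positivity/eqP; rewrite eq_le mdist_ge0 andbT.
  apply: (@le_of_half_pow _ _ _ L) => n; rewrite add0r.
  have := gP 1 ler01 n.
  by rewrite /u mulr1 -natrX natrK /D dyadic_point_last.
move=> p q p0 pq; have q0 := le_trans p0 pq.
(* Three errors of size L / 2^n: one for each of the two limits, and one from rounding, since k - j
   <= 2^n (q - p) + 1. *)
apply: (@le_of_half_pow _ _ _ (3 * L)) => n.
have := gP _ p0 n; have := gP _ q0 n.
suff : mdist (u p n) (u q n) <= L * (q - p) + L / 2 ^+ n.
  have := metric_triangle (g p) (u p n) (g q).
  have := metric_triangle (u p n) (u q n) (g q).
  rewrite (metric_sym (g p) (u p n)); lra.
rewrite /u; set j := Num.truncn _; set k := Num.truncn _.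
have jk : (j <= k)%N by rewrite le_truncn// ler_wpM2l// ltW.
have := dyadic_point_lipschitz s0 s_ge0 midP n j (k - j).
rewrite subnKC// => /le_trans; apply.
apply: le_trans (ler_wpM2l (ler0n _ _) (s_le n)) _.
rewrite mulrCA -mulrDr ler_wpM2l ?addr_ge0 ?(ltW e0)//.
rewrite ler_pdivrMr// mulrDl mulVf ?gt_eqF// natrB//.
have /andP[k1 k2] := truncn_itv (mulr_ge0 (ltW (P0 n)) q0).
have /andP[j1 j2] := truncn_itv (mulr_ge0 (ltW (P0 n)) p0).
rewrite -/j -/k -!natr1 in j1 j2 k1 k2 *; lra.
Qed.

(** * Lengths of Lipschitz curves *)

Lemma curve_length_ge (R : realType) (M : metricType R) (g : R -> M) :
  ((mdist (g 0) (g 1))%:E <= curve_length g)%E.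
Proof.
apply: ereal_sup_ubound; exists [:: 1]; first exact: itv_partition1.
by rewrite /polygonal_length/= big_nat1.
Qed.

Lemma lipschitz_curve_length (R : realType) (M : metricType R) (g : R -> M)
    (L : R) :
  (forall s t, 0 <= s -> s <= t -> mdist (g s) (g t) <= L * (t - s)) ->
  (curve_length g <= L%:E)%E.
Proof.
move=> gL; apply: ge_ereal_sup => _ [s sP <-]; rewrite lee_fin.
pose G n := nth 1 (0 :: s) n.
rewrite /polygonal_length.
apply: (@le_trans _ _ (\sum_(0 <= n < size s) L * (G n.+1 - G n))).
  rewrite !big_nat; apply: ler_sum => n /andP[_ ns]; apply: gL.
    by rewrite (itv_partition_nth_ge _ sP)// ltnS ltnW.
  case: sP => sP _; have /pathP := sP => /(_ 1 n ns) /ltW.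
  by [].
rewrite -mulr_sumr telescope_sumr// /G.
by rewrite (itv_partition_nth_size _ sP)/= subr0 mulr1.
Qed.

Lemma lipschitz_curve_continuous (R : realType) (M : metricType R) (g : R -> M)
    (L : R) :
  (forall s t, 0 <= s -> s <= t -> mdist (g s) (g t) <= L * (t - s)) ->
  {within `[0, 1], continuous g}.
Proof.
move=> gL; have L0 : 0 <= L.
  have := gL 0 1 (lexx _) ler01; rewrite subr0 mulr1.
  by apply: le_trans; exact: mdist_ge0.
(* Freezing [g] to the left of 0 gives a map that is Lipschitz on the whole line, so that continuity
   within the interval follows from plain continuity. *)
have E : {in `[0, 1]%classic, g \o Num.max 0 =1 g}.
  by move=> t; rewrite inE/= in_itv/= => /andP[t0 _]; rewrite /= max_r.
apply: (subspace_eq_continuous E); apply: continuous_subspaceT => t.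
apply/metricType_numDomainType.cvgrPdist_le => e e0; near=> u.
have uL (a b : R) : a <= b ->
    mdist (g (Num.max 0 a)) (g (Num.max 0 b)) <= L * (b - a).
  move=> ab; have [a0|a0] := leP 0 a.
    by rewrite !max_r// ?(le_trans a0)// gL.
  have [b0|b0] := leP 0 b; last first.
    by rewrite mdistxx mulr_ge0// subr_ge0.
  by rewrite (le_trans (gL _ _ _ _))// ler_wpM2l// lerD2l lerN2 ltW.
apply: (@le_trans _ _ (L * `|t - u|)).
  have [tu|ut] := leP t u; first by rewrite distrC ger0_norm ?subr_ge0// uL.
  by rewrite metric_sym ger0_norm ?subr_ge0 ?uL// ltW.
have : `|t - u| <= e / (L + 1).
  near: u; apply: cvgr_dist_le; first exact: cvg_id.
  by rewrite divr_gt0// ltr_pwDr.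
rewrite ler_pdivlMr; last by rewrite ltr_pwDr.
by rewrite mulrDr mulr1 mulrC; apply: le_trans; rewrite lerDl.
Unshelve. all: by end_near. Qed.

Lemma approx_midpoints_length_space (R : realType) (M : completeMetricType R) :
  approx_midpoints M -> length_space M.
Proof.
move=> AM x y; apply/eqP; rewrite eq_le; apply/andP; split.
  apply: le_ereal_inf_tmp => _ [g [[_ <- <-] _] <-]; exact: curve_length_ge.
apply/lee_addgt0Pr => e e0; rewrite -EFinD.
have [g [g0 g1 gL]] := approx_midpoints_lipschitz_curve x y AM e0.
have glen := lipschitz_curve_length gL.
apply: ge_ereal_inf; exists (curve_length g) => //; exists g => //; split.
  by split => //; exact: (lipschitz_curve_continuous gL).
by rewrite /rectifiable (le_lt_trans glen)// ltry.
Qed.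

(** * Norms in Lip_0(M) and F(M) *)

Section norms.
Context {R : realType}.

Lemma op_norm_gtP (X Y : normedModType R) (T : boundedOp X Y) (k : R) :
  k < `|T| -> exists2 x, `|x| <= 1 & k < `|T x|.
Proof.
move=> kT; have [S0 _] := op_norm_has_sup T.
by have [_ [x x1 <-] kx] := sup_gt S0 kT; exists x.
Qed.

Variable M : pointedMetricType R.
Implicit Types f g : lip0 M.

Lemma lip0_ub f (u v : M) : f u - f v <= `|f| * mdist u v.
Proof. exact: le_trans (ler_norm _) (lip_norm_ub f u v). Qed.

Lemma lip0_norm_le f k : 0 <= k ->
  (forall u v, f u - f v <= k * mdist u v) -> `|f| <= k.
Proof.
move=> k0 fk; apply: lip_norm_le => // u v.
by rewrite ler_norml fk andbT lerNl opprB metric_sym fk.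
Qed.

Lemma lip0_norm_gtP f k : 0 <= k -> k < `|f| ->
  exists u v, u != v /\ k * mdist u v < f u - f v.
Proof.
move=> k0; apply: contraPP => /forallNP h; apply/negP; rewrite -leNgt.
apply: lip0_norm_le => // u v; have [->|uv] := eqVneq u v.
  by rewrite subrr mdistxx mulr0.
by rewrite leNgt; apply/negP => fuv; apply: (h u); exists v.
Qed.

(** Subtracting the value at the base point changes no increment, so functions can be built without
    regard to the base point. *)
Definition lip0_of (h : M -> R^o) (k : R)
  (hk : forall u v, `|h u - h v| <= k * mdist u v) : lip0 M.
Proof.
exists (fun u => h u - h point); rewrite inE; split; first by rewrite subrr.
by exists k => u v; rewrite opprB addrA subrK hk.
Defined.

Lemma lip0_ofE h k hk u : @lip0_of h k hk u = h u - h point.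
Proof. by []. Qed.

Lemma lip0_ofB h k hk u v : @lip0_of h k hk u - @lip0_of h k hk v = h u - h v.
Proof. by rewrite !lip0_ofE opprB addrA subrK. Qed.

Lemma lip0_of_norm h k hk : 0 <= k -> `|@lip0_of h k hk| <= k.
Proof.
move=> k0; apply: lip_norm_le => // u v.
by rewrite lip0_ofB hk.
Qed.

End norms.

Section closed_span_val.
Context {R : realType} (V : normedModType R) (A : set V).
Implicit Types u v : closedSpan A.

Lemma cspan_valD u v : cspan_val (u + v) = cspan_val u + cspan_val v.
Proof. reflexivity. Qed.

Lemma cspan_valZ a u : cspan_val (a *: u) = a *: cspan_val u.
Proof. reflexivity. Qed.

Lemma cspan_normE u : `|u| = `|cspan_val u|.
Proof. reflexivity. Qed.

End closed_span_val.

(** * Elements of F(M) as functionals on Lip_0(M) *)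

Section free.
Context {R : realType} (M : pointedMetricType R).
Implicit Types (f g : lip0 M) (mu nu : free_space M).

Lemma delta_in_closed_span (x : M) :
  delta x \in in_closed_span (range (@delta R M)).
Proof.
rewrite inE; apply: subset_closure; exists 1%N, (fun=> 1), (fun=> delta x).
by split; [move=> _; exists x|rewrite big_ord_recl big_ord0 addr0 scale1r].
Qed.

Definition fdelta (x : M) : free_space M :=
  ClosedSpan (delta_in_closed_span x).

Definition feval mu f : R := cspan_val mu f.

Lemma feval_delta x f : feval (fdelta x) f = f x. Proof. by []. Qed.

Lemma fevalDl mu nu f : feval (mu + nu) f = feval mu f + feval nu f.
Proof. by rewrite /feval cspan_valD bopDE. Qed.

Lemma fevalZl a mu f : feval (a *: mu) f = a * feval mu f.
Proof. by rewrite /feval cspan_valZ bopZE. Qed.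

Lemma fevalNl mu f : feval (- mu) f = - feval mu f.
Proof. by rewrite -scaleN1r fevalZl mulN1r. Qed.

Lemma fevalDr mu f g : feval mu (f + g) = feval mu f + feval mu g.
Proof. exact: linearD. Qed.

Lemma fevalZr a mu f : feval mu (a *: f) = a * feval mu f.
Proof. exact: linearZ. Qed.

Lemma fevalNr mu f : feval mu (- f) = - feval mu f.
Proof. exact: linearN. Qed.

Lemma feval_ub mu f : `|feval mu f| <= `|mu| * `|f|.
Proof. rewrite cspan_normE; exact: (op_norm_ub (cspan_val mu) f). Qed.

Lemma free_norm_le mu k : 0 <= k ->
  (forall f, feval mu f <= k * `|f|) -> `|mu| <= k.
Proof.
move=> k0 h; apply: (op_norm_le k0) => f.
rewrite ler_norml h andbT lerNl.
by have := h (- f); rewrite fevalNr normrN.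
Qed.

Lemma free_norm_gtP mu k : k < `|mu| ->
  exists2 f, `|f| <= 1 & k < feval mu f.
Proof.
move=> /(op_norm_gtP (T := cspan_val mu))[f f1 kf].
have [f0|f0] := leP 0 (feval mu f).
  by exists f => //; rewrite -(ger0_norm f0).
exists (- f); first by rewrite normrN.
by rewrite fevalNr -(ltr0_norm f0).
Qed.

Lemma fdeltaB_norm (x y : M) : `|fdelta x - fdelta y| <= mdist x y.
Proof.
apply: free_norm_le => [|f]; first exact: mdist_ge0.
by rewrite fevalDl fevalNl !feval_delta mulrC lip0_ub.
Qed.

End free.

(** * From the Daugavet property of F(M) to approximate midpoints *)

Section free_midpoints.
Context {R : realType} (M : pointedMetricType R).
Implicit Types (f g : lip0 M) (mu nu : free_space M).
Hypothesis DP : daugavet_property (free_space M).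

(** For T mu = mu(f) m with m = (delta_y - delta_x) / d(x, y), the Daugavet equation gives [mu] and
    [g] in the unit balls with mu(f) m(g) + mu(g) close to 2. All three numbers are at most 1 in
    absolute value, so all are close to 1 or -1. Hence [f + g] has norm close to 2. *)
Let slope_pair_normalized (x y : M) f (e : R) : x != y -> `|f| = 1 ->
  0 < e -> e < 1 ->
  exists g u v, [/\ `|g| <= 1, u != v,
    (2 - e) * mdist u v < (f u + g u) - (f v + g v) &
    (1 - e) * mdist x y < g y - g x].
Proof.
move=> xy f1 e0 e1; have d0 : 0 < mdist x y by rewrite mdist_gt0.
pose m : free_space M := (mdist x y)^-1 *: (fdelta y - fdelta x).
have mE g : feval m g = (g y - g x) / mdist x y.
  by rewrite fevalZl fevalDl fevalNl !feval_delta mulrC.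
have m1 : `|m| <= 1.
  rewrite normrZ ger0_norm ?invr_ge0 ?(ltW d0)// ler_pdivrMl// mulr1.
  by rewrite metric_sym fdeltaB_norm.
have TP : (fun mu => feval mu f *: m) \in
    bounded_linear (free_space M) (free_space M).
  rewrite inE; split.
    by move=> a mu nu; rewrite fevalDl fevalZl scalerDl -scalerA.
  exists 1 => mu; rewrite normrZ mul1r.
  have := feval_ub mu f; rewrite f1 mulr1 => muf.
  by rewrite (le_trans (ler_wpM2r _ muf))// ler_piMr.
pose T := BoundedOp TP.
have TE mu : T mu = feval mu f *: m by [].
pose e' := e / 2; have e'0 : 0 < e' by rewrite divr_gt0.
have e'e : e = 2 * e' by rewrite /e' mulrC divfK.
have [u0 [v0 [uv0 fuv0]]] : exists u v, u != v /\
    (1 - e') * mdist u v < f u - f v.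
  apply: lip0_norm_gtP; first by lra.
  by rewrite f1; lra.
have duv0 : 0 < mdist u0 v0 by rewrite mdist_gt0.
pose mu0 : free_space M := (mdist u0 v0)^-1 *: (fdelta u0 - fdelta v0).
have mu0f : feval mu0 f = (f u0 - f v0) / mdist u0 v0.
  by rewrite fevalZl fevalDl fevalNl !feval_delta mulrC.
have mu0f_gt : 1 - e' < feval mu0 f by rewrite mu0f ltr_pdivlMr.
have mu01 : `|mu0| <= 1.
  rewrite normrZ ger0_norm ?invr_ge0 ?(ltW duv0)// ler_pdivrMl// mulr1.
  by rewrite fdeltaB_norm.
(* The distance to [x] is 1-Lipschitz and shows that [m] has norm at least 1. *)
have hk u v : `|(mdist x u : R^o) - mdist x v| <= 1 * mdist u v.
  have := metric_triangle x u v; have := metric_triangle x v u.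
  by rewrite (metric_sym v u) ler_norml => *; apply/andP; split; lra.
have m_ge1 : 1 <= `|m|.
  have := feval_ub m (lip0_of hk); rewrite mE !lip0_ofE mdistxx.
  rewrite opprB addrA subrK subr0 divff ?gt_eqF// normr1 => /le_trans; apply.
  by rewrite ler_piMr// lip0_of_norm.
have T_rank_one : rank_one T.
  exists m; first by rewrite -normr_gt0 (lt_le_trans ltr01).
  apply/seteqP; split=> [_ [mu _ <-]|_ [a _ <-]].
    by exists (feval mu f).
  exists ((a / feval mu0 f) *: mu0) => //.
  rewrite TE fevalZl divfK// gt_eqF// (lt_trans _ mu0f_gt)//; lra.
have T_gt : 1 - e' < `|T|.
  apply: (@lt_le_trans _ _ `|T mu0|).
    rewrite TE normrZ; apply: (lt_le_trans mu0f_gt).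
    by rewrite (le_trans (ler_norm _))// ler_peMr.
  apply: le_trans (op_norm_ub T mu0) _.
  exact: (ler_piMr (op_norm_ge0 T) mu01).
have : 2 - e' < `|T + id_op (free_space M)| by rewrite (DP T_rank_one); lra.
move=> /op_norm_gtP[mu mu1]; rewrite bopDE TE /= => /free_norm_gtP[g g1].
rewrite fevalDl fevalZl.
have ub1 nu h : `|nu| <= 1 -> `|h| <= 1 -> `|feval nu h| <= 1.
  by move=> nu1 h1; rewrite (le_trans (feval_ub _ _))// mulr_ile1.
have := ub1 mu f mu1; rewrite f1 lexx => /(_ isT).
have := ub1 _ _ mu1 g1; have := ub1 _ _ m1 g1.
rewrite !ler_norml => /andP[b1 b2] /andP[c1 c2] /andP[a1 a2] abc.
suff [g' [g'1 mug' mg']] : exists g', [/\ `|g'| <= 1,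
    2 - e < `|f + g'| & 1 - e < feval m g'].
  have [|u [v [uv fguv]]] := lip0_norm_gtP _ mug'; first by lra.
  exists g', u, v; split => //.
  by rewrite -ltr_pdivlMr// -mE.
have sumge s : 2 - e < feval mu f + feval mu s \/
    2 - e < - (feval mu f + feval mu s) -> 2 - e < `|f + s|.
  rewrite -fevalDr => h.
  apply: (@lt_le_trans _ _ `|feval mu (f + s)|).
    by rewrite ltr_normr; apply/orP.
  by rewrite (le_trans (feval_ub _ _))// ler_piMl.
(* If mu(f) is close to -1, so is m(g), while mu(g) is close to 1; then [- g] works, since mu(f - g)
   is close to -2. Two errors e' = e / 2 add up to [e]. *)
have [a0|a0] := leP 0 (feval mu f).
  exists g; split => //; last by nra.
  by apply: sumge; left; nra.
exists (- g); rewrite normrN !fevalNr; split => //; last by nra.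
by apply: sumge; right; rewrite fevalNr; nra.
Qed.

Lemma free_daugavet_approx_midpoints : approx_midpoints M.
Proof.
move=> x y s ds; apply: contrapT => /forallNP no_mid.
have [xy|xy] := eqVneq x y.
  apply: (no_mid x); rewrite -xy mdistxx; move: ds.
  by rewrite xy mdistxx => ds; split; lra.
have d0 : 0 < mdist x y by rewrite mdist_gt0.
(* The bumps [P x] and [P y] have height [r], slope [c = r / s'] and vanish outside balls of radius
   [s']. As [s'] exceeds [r], the slope is below 1, and [e] is small enough that even c < 1 - e. *)
set d := mdist x y in ds d0; pose r := d / 2; pose s' := r + (s - r) / 4.
have rs : r < s by rewrite /r; lra.
have r0 : 0 < r by rewrite divr_gt0.
have dr : d = 2 * r by rewrite /r mulrC divfK.
have s'0 : 0 < s' by rewrite /s'; lra.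
have s's : s' < s by rewrite /s'; lra.
have sd : s < d.
  rewrite ltNge; apply/negP => ds'; apply: (no_mid y).
  by rewrite mdistxx; split => //; lra.
pose c := r / s'; have cs' : c * s' = r by rewrite /c divfK ?gt_eqF.
have c0 : 0 < c by rewrite divr_gt0.
pose e := (s - r) / (8 * s).
have s0 : 0 < s := lt_trans r0 rs.
have es : e * s = (s - r) / 8 by rewrite /e; field; rewrite gt_eqF.
have e0 : 0 < e by rewrite divr_gt0 ?subr_gt0 ?mulr_gt0.
have e1 : e < 1 by rewrite -(ltr_pM2r s0) es; lra.
have ce : c < 1 - e by rewrite -(ltr_pM2r s'0) cs' /s'; nra.
pose P (w z : M) := Num.max (r - c * mdist w z) 0.
have P_ge0 w z : 0 <= P w z by rewrite le_max lexx orbT.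
have P_gt0 w z : 0 < P w z -> mdist w z < s'.
  by rewrite /P lt_max ltxx orbF subr_gt0 -cs' ltr_pM2l.
have P_lip w u v : P w u - P w v <= c * mdist u v.
  have : c * mdist w v <= c * mdist w u + c * mdist u v.
    by rewrite -mulrDr ler_pM2l// metric_triangle.
  have : 0 <= c * mdist u v by rewrite mulr_ge0 ?mdist_ge0 ?ltW.
  rewrite /P; have [?|?] := leP (r - c * mdist w u) 0;
    have [?|?] := leP (r - c * mdist w v) 0; lra.
pose h (z : M) : R^o := P x z - P y z.
have hk u v : `|h u - h v| <= (2 * c) * mdist u v.
  have := P_lip x u v; have := P_lip x v u.
  have := P_lip y u v; have := P_lip y v u.
  rewrite /h (metric_sym v u) => *.
  by rewrite ler_norml; apply/andP; split; lra.
have Pxx w : P w w = r by rewrite /P mdistxx mulr0 subr0 max_l// ltW.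
have Pxy w z : mdist w z = d -> P w z = 0.
  move=> wz; rewrite /P max_r// wz subr_le0 -cs' ler_pM2l//.
  by rewrite ltW// (lt_trans s's).
pose f := lip0_of hk.
have fE u v : f u - f v = h u - h v by exact: lip0_ofB.
(* The increment of [f] from [y] to [x] is 2 r = d. Since the norm is at least 1, slope above 1 - e
   for the normalized function implies the same for [f]. *)
have f_ge1 : 1 <= `|f|.
  rewrite -(ler_pM2r d0) mul1r; apply: le_trans (lip0_ub f x y).
  rewrite fE /h !Pxx (Pxy x y)// (Pxy y x) ?dr; last by rewrite metric_sym.
  lra.
have f0 : 0 < `|f| by rewrite (lt_le_trans ltr01).
have f1 : `| `|f|^-1 *: f| = 1.
  by rewrite normrZ ger0_norm ?invr_ge0// mulVf// gt_eqF.
have [g [u [v [g1 uv fguv gyx]]]] := slope_pair_normalized xy f1 e0 e1.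
have duv : 0 < mdist u v by rewrite mdist_gt0.
have glip a b : g a - g b <= mdist a b.
  by rewrite (le_trans (lip0_ub g a b))// ler_piMl// mdist_ge0.
move: fguv; rewrite !lip0ZE.
have -> : `|f|^-1 *: f u + g u - (`|f|^-1 *: f v + g v) =
   `|f|^-1 * (f u - f v) + (g u - g v) by rewrite /GRing.scale/=; ring.
move=> fguv.
have fuv : (1 - e) * mdist u v < f u - f v.
  have : (1 - e) * mdist u v < `|f|^-1 * (f u - f v).
    by have := glip u v; lra.
  rewrite [X in _ < X]mulrC ltr_pdivlMr// => /(le_lt_trans _); apply.
  by rewrite ler_peMr// mulr_ge0 ?(ltW duv)// subr_ge0 ltW.
have guv : (1 - e) * mdist u v < g u - g v.
  have := lip0_ub (`|f|^-1 *: f) u v; rewrite f1 mul1r !lip0ZE.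
  rewrite -scalerBr => le1.
  have : `|f|^-1 * (f u - f v) <= mdist u v := le1.
  lra.
have cuv : c * mdist u v < h u - h v.
  by rewrite -fE (lt_trans _ fuv)// ltr_pM2r.
(* If [P x u] were 0, only the bump around [y] could raise [h u - h v], and its slope is just [c].
   The same argument locates [v] near [y]. *)
have xu : mdist x u < s'.
  apply: P_gt0; rewrite lt_neqAle P_ge0 andbT; apply/eqP => Pxu.
  have := P_lip y v u; have := P_ge0 x v; move: cuv.
  by rewrite /h -Pxu (metric_sym v u); lra.
have yv : mdist y v < s'.
  apply: P_gt0; rewrite lt_neqAle P_ge0 andbT; apply/eqP => Pyv.
  have := P_lip x u v; have := P_ge0 y u; move: cuv.
  by rewrite /h -Pyv; lra.
have xv : s < mdist x v.
  rewrite ltNge; apply/negP => xv; apply: (no_mid v); split => //.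
  by rewrite metric_sym ltW// (lt_trans yv).
have yu : s < mdist y u.
  rewrite ltNge; apply/negP => yu; apply: (no_mid u).
  by rewrite (metric_sym u); split => //; rewrite ltW// (lt_trans xu).
have := metric_triangle x u v; have := metric_triangle y v u.
rewrite (metric_sym v u) => t1 t2.
have := glip y v; have := glip u x; rewrite (metric_sym u x) => g2 g3.
have es' : 2 * (s * e) = (s - r) / 4 by rewrite (mulrC s) es; lra.
(* The increments of [g] along (x, y) and (v, u) regroup into those along (v, y) and (x, u), each
   below [s']. But d(u, v) > s - s', and with e s = (s - r) / 8 the left side is too large. *)
have key : (1 - e) * (d + mdist u v) < 2 * s'.
  by rewrite mulrDr; rewrite -/d in gyx; lra.
have : (1 - e) * (d + (s - s')) <= (1 - e) * (d + mdist u v).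
  by rewrite ler_wpM2l ?subr_ge0 ?(ltW e1)// lerD2l; lra.
rewrite dr in key *; rewrite /s' in key *; nra.
Qed.

End free_midpoints.

(** * Duality *)

Section preadjoint.
Context {R : realType} (M : pointedMetricType R).
Implicit Types (f g : lip0 M) (mu nu : free_space M).

Lemma free_span_dense mu (e : R) : 0 < e ->
  exists n (a : 'I_n -> R) (x : 'I_n -> M),
    `|mu - \sum_i a i *: fdelta (x i)| < e.
Proof.
move=> e0; have := cspan_valP mu; rewrite inE => cl.
have [nu [[n [a [u [uP ->]]]] mue]] := cl _ (nbhsx_ballx (cspan_val mu) e e0).
have /choice[x xP] : forall i, exists x, delta x = u i.
  by move=> i; have [x _ <-] := uP i; exists x.
exists n, a, x; rewrite cspan_normE.
suff -> : cspan_val (mu - \sum_i a i *: fdelta (x i)) =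
    cspan_val mu - \sum_i a i *: u i by move: mue; rewrite -ball_normE.
rewrite -scaleN1r cspan_valD cspan_valZ scaleN1r; congr (_ - _).
rewrite (big_morph (@cspan_val _ _ _) (@cspan_valD _ _ _) (erefl _)).
by apply: eq_bigr => i _; rewrite cspan_valZ -xP.
Qed.

(** Density of the span of the point evaluations; [G] is left unbundled so that a difference of two
    functionals can be inserted directly. *)
Lemma free_ext (G : free_space M -> R) (K : R) :
  (forall a mu nu, G (a *: mu + nu) = a * G mu + G nu) ->
  (forall mu, `|G mu| <= K * `|mu|) ->
  (forall x, G (fdelta x) = 0) -> forall mu, G mu = 0.
Proof.
move=> Glin GK G0 mu; apply/eqP; rewrite -normr_le0.
apply/ler_addgt0Pr => e e0; rewrite add0r.
have G00 : G 0 = 0.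
  by have := Glin (-1) 0 0; rewrite scaler0 addr0 mulN1r addNr.
have K1 : 0 < `|K| + 1 := ltr_wpDl (normr_ge0 K) ltr01.
have [n [a [x xmu]]] := free_span_dense mu (divr_gt0 e0 K1).
set nu := \sum_i _ in xmu.
have Gnu : G nu = 0.
  rewrite /nu; elim/big_rec : _ => // i k _ kG.
  by rewrite Glin G0 mulr0 kG addr0.
have -> : mu = 1 *: (mu - nu) + nu by rewrite scale1r subrK.
rewrite Glin mul1r Gnu addr0 (le_trans (GK _))//.
move: xmu; rewrite ltr_pdivlMr// => xmu.
apply: (le_trans _ (ltW xmu)); rewrite mulrC ler_wpM2l//.
by rewrite (le_trans (ler_norm K))// lerDl.
Qed.

Lemma fdelta_point : fdelta (point : M) = 0.
Proof.
apply/eqP; rewrite -normr_le0; apply: free_norm_le => // f.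
by rewrite feval_delta lip0_point mul0r.
Qed.

Variable T : boundedOp (free_space M) (free_space M).

Let Tdelta_lip f u v :
  `|feval (T (fdelta u)) f - feval (T (fdelta v)) f| <=
    `|T| * `|f| * mdist u v.
Proof.
rewrite -fevalNl -fevalDl -linearB.
rewrite (le_trans (feval_ub _ _))// mulrAC ler_wpM2r//.
apply: le_trans (op_norm_ub T _) _.
exact: (ler_wpM2l (op_norm_ge0 T) (fdeltaB_norm u v)).
Qed.

Let preadj_lip0 f : (fun x => feval (T (fdelta x)) f) \in @lipschitz0 R M.
Proof.
rewrite inE; split; last by exists (`|T| * `|f|); exact: Tdelta_lip.
by rewrite fdelta_point linear0 -(scale0r (fdelta point)) fevalZl mul0r.
Qed.

Let preadj f : lip0 M := Lip0 (preadj_lip0 f).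

Let preadj_bounded_linear : preadj \in bounded_linear (lip0 M) (lip0 M).
Proof.
rewrite inE; split.
  move=> a f g; apply/val_inj/funext => x.
  by rewrite [LHS]fevalDr fevalZr.
exists `|T| => f; apply: lip_norm_le; first by rewrite mulr_ge0.
exact: Tdelta_lip.
Qed.

(** The adjoint of [T], acting on Lip_0(M) as the dual of F(M). *)
Definition preadjoint : boundedOp (lip0 M) (lip0 M) :=
  BoundedOp preadj_bounded_linear.

Lemma preadjointE f x : preadjoint f x = feval (T (fdelta x)) f.
Proof. by []. Qed.

(** Both sides are bounded and linear in [mu] and agree at each [fdelta x], so [free_ext] applies to
    their difference. *)
Lemma feval_preadjoint mu f : feval (T mu) f = feval mu (preadjoint f).
Proof.
apply/eqP; rewrite -subr_eq0; apply/eqP; move: mu.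
apply: (@free_ext _ (`|T| * `|f| + `|preadjoint f|)).
- move=> a mu nu; rewrite linearP !fevalDl !fevalZl; ring.
- move=> mu; rewrite (le_trans (ler_normB _ _))// mulrDl lerD//.
    rewrite (le_trans (feval_ub _ _))// mulrAC ler_wpM2r//.
    exact: op_norm_ub.
  by rewrite mulrC feval_ub.
- by move=> x; rewrite feval_delta preadjointE subrr.
Qed.

Lemma preadjoint_norm : `|preadjoint| = `|T|.
Proof.
apply/eqP; rewrite eq_le; apply/andP; split.
  apply: op_norm_le => // f; apply: lip_norm_le; first by rewrite mulr_ge0.
  exact: Tdelta_lip.
apply: op_norm_le => // mu; apply: free_norm_le; first by rewrite mulr_ge0.
move=> f; rewrite feval_preadjoint (le_trans (ler_norm _))//.
rewrite (le_trans (feval_ub _ _))// (mulrC `|preadjoint|) -mulrA ler_wpM2l//.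
exact: op_norm_ub.
Qed.

(** If T mu = a(mu) nu, the adjoint sends [g] to nu(g) a. Thus any [f] with nu(f) > 0 gives a
    spanning vector, which is nonzero because [nu] is itself a value of [T]. *)
Lemma preadjoint_rank_one : rank_one T -> rank_one preadjoint.
Proof.
move=> [nu nu0 Tnu].
have Tphi mu : exists a, T mu = a *: nu.
  have : range T (T mu) by exists mu.
  by rewrite Tnu => -[a _ <-]; exists a.
have [f _ nuf] : exists2 f, `|f| <= 1 & 0 < feval nu f.
  by apply: free_norm_gtP; rewrite normr_gt0.
have scal g : preadjoint g = (feval nu g / feval nu f) *: preadjoint f.
  apply/val_inj/funext => x.
  rewrite [LHS]preadjointE [RHS]lip0ZE preadjointE.
  have [a ->] := Tphi (fdelta x); rewrite !fevalZl /GRing.scale/=.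
  by field; rewrite gt_eqF.
exists (preadjoint f).
  apply/eqP => f0.
  have [mu _ muE] : range T nu by rewrite Tnu; exists 1; rewrite ?scale1r.
  have := feval_preadjoint mu f; rewrite muE f0.
  rewrite -(scale0r f) fevalZr mul0r => nuf0.
  by rewrite nuf0 ltxx in nuf.
apply/seteqP; split=> [_ [g _ <-]|_ [a _ <-]].
  by exists (feval nu g / feval nu f) => //; rewrite -scal.
by exists (a *: f) => //; rewrite linearZ.
Qed.

End preadjoint.

Lemma preadjointD1 (R : realType) (M : pointedMetricType R)
    (T : boundedOp (free_space M) (free_space M)) :
  preadjoint (T + id_op (free_space M)) = preadjoint T + id_op (lip0 M).
Proof.
apply/val_inj/funext => f; apply/val_inj/funext => x.
rewrite [LHS]preadjointE [RHS]lip0DE preadjointE.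
by rewrite bopDE fevalDl.
Qed.

Lemma lip0_daugavet_free (R : realType) (M : pointedMetricType R) :
  daugavet_property (lip0 M) -> daugavet_property (free_space M).
Proof.
move=> DP T T1; rewrite -preadjoint_norm preadjointD1.
by rewrite (DP _ (preadjoint_rank_one T1)) preadjoint_norm.
Qed.

(** * Lipschitz functions on length spaces *)

(** On a curve of length below d(x, y) + e, the intermediate value theorem finds a point at the
    exact distance from [x]; the partition through it bounds the distance to [y]. *)
Lemma length_space_between (R : realType) (M : metricType R) (x y : M)
    (a e : R) : length_space M -> 0 <= a -> a <= 1 -> 0 < e ->
  exists z, mdist x z = a * mdist x y /\
            mdist z y <= (1 - a) * mdist x y + e.
Proof.
move=> LM a0 a1 e0.
have : (ereal_inf [set curve_length g | g in [set g | joining_curve x y g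
    /\ rectifiable g]] < (mdist x y + e)%:E)%E.
  by rewrite -LM lte_fin ltrDl.
move=> /ereal_inf_lt[_ [g [[gc g0 g1] _] <-]] glt.
have dc (z : M) : continuous (fun w => mdist z w : R).
  move=> w; apply/cvgrPdist_le => eps eps0; near=> w'.
  have : mdist w w' <= eps.
    near: w'; have := nbhsx_ballx w _ eps0; rewrite ballEmdist.
    by apply: filterS => u /ltW.
  apply: le_trans; rewrite ler_norml.
  have := metric_triangle z w w'; have := metric_triangle z w' w.
  by rewrite (metric_sym w' w) => *; apply/andP; split; lra.
have hc : {within `[0, 1], continuous (fun t => mdist x (g t))}.
  move=> t; apply: (cvg_comp _ _ (gc t)); exact: dc.
have d0 : 0 <= mdist x y := mdist_ge0 _ _.
have [|c] := IVT ler01 hc (v := a * mdist x y).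
  rewrite g0 g1 mdistxx min_l// max_r// mulr_ge0//=.
  by rewrite ler_piMl.
rewrite in_itv/= => /andP[c0 c1] gc_eq.
exists (g c); split => //.
suff : mdist x (g c) + mdist (g c) y <= mdist x y + e by lra.
(* Partitions increase strictly, so the end points are treated apart. *)
have [c_eq0|cn0] := eqVneq c 0.
  by rewrite c_eq0 g0 mdistxx add0r lerDl ltW.
have [c_eq1|cn1] := eqVneq c 1.
  by rewrite c_eq1 g1 mdistxx addr0 lerDl ltW.
have c_gt0 : 0 < c by rewrite lt_neqAle eq_sym cn0.
have c_lt1 : c < 1 by rewrite lt_neqAle cn1.
rewrite -lee_fin (le_trans _ (ltW glt))//.
apply: ereal_sup_ubound; exists [:: c; 1].
  by rewrite /itv_partition/= c_gt0 c_lt1.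
by rewrite /polygonal_length/= big_nat_recr//= big_nat1/= g0 g1.
Unshelve. all: by end_near. Qed.

Section lip0_length.
Context {R : realType} (M : pointedMetricType R).
Implicit Types f g h : lip0 M.

Lemma length_space_small_pairs g (n : nat) (e : R) : length_space M ->
  0 < e -> e <= 1 -> e <= `|g| ->
  exists p q : nat -> M,
    (forall k, (k < n)%N -> p k != q k /\
       (`|g| - e) * mdist (p k) (q k) <= g (p k) - g (q k)) /\
    (forall j k w, (j < n)%N -> (k < n)%N ->
       mdist (q j) w < 2 * mdist (p j) (q j) / e ->
       mdist (q k) w < 2 * mdist (p k) (q k) / e -> j = k).
Proof.
move=> LM e0 e1 eN; set N := `|g| in eN *.
have N0 : 0 < N := lt_le_trans e0 eN.
have [n' [n'1 nn']] : exists n' : R, 1 <= n' /\ n%:R <= n'.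
  by exists n.+1%:R; rewrite ler1n ler_nat leqnSn.
have n'0 : 0 < n' := lt_le_trans ltr01 n'1.
(* With d(p_k, q_k) about m d(x, y), the ball of radius 2 d(p_k, q_k) / e around
   q_k stays within d(x, y) / (4 n') of p_k, while the distances d(x, p_k) are
   d(x, y) / (2 n') apart. *)
pose m := e / (24 * n').
have mn : m * (24 * n') = e by rewrite /m divfK// gt_eqF// mulr_gt0.
have m0 : 0 < m by rewrite divr_gt0// mulr_gt0.
have m1 : m <= 1.
  by rewrite -(ler_pM2r (_ : 0 < 24 * n')) ?mulr_gt0// mn; lra.
(* Three losses of th d occur: one in the slope of (x, y), and two of N de = th d from the
   approximate points [p k] and [q k]. Their sum e m d / 2 is at most e m d(p_k, y), as d(p_k, y) >=
   d / 2. *)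
pose th := e * m / 6; have th0 : 0 < th by rewrite divr_gt0// mulr_gt0.
have thN : th < N by rewrite /th; nra.
have Nth0 : 0 <= N - th by rewrite subr_ge0 ltW.
have Nth : N - th < `|g| by rewrite gtrBl.
have [x [y [xy gxy]]] := lip0_norm_gtP Nth0 Nth.
set d := mdist x y in gxy; have d0 : 0 < d by rewrite mdist_gt0.
pose de := th * d / N; have de0 : 0 < de by rewrite divr_gt0// mulr_gt0.
have deN : N * de = th * d by rewrite mulrC /de divfK// gt_eqF.
have ded : de <= d by rewrite ler_pdivrMr// mulrC ler_pM2l// ltW.
pose la k : R := k%:R / (2 * n').
have la0 k : 0 <= la k by rewrite divr_ge0// mulr_ge0// ltW.
have la1 k : (k < n)%N -> la k <= 1 / 2.
  move=> kn; rewrite ler_pdivrMr ?mulr_gt0//.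
  have -> : 1 / 2 * (2 * n') = n' by field.
  by rewrite (le_trans _ nn')// ler_nat ltnW.
have /choice[p pP] : forall k, exists z, (k < n)%N ->
    mdist x z = la k * d /\ mdist z y <= (1 - la k) * d + de.
  move=> k; have [kn|] := ltnP k n; last by exists x.
  have lak : la k <= 1 by rewrite (le_trans (la1 k kn))//; lra.
  by have [z zP] := length_space_between x y LM (la0 k) lak de0; exists z.
have /choice[q qP] : forall k, exists z,
    mdist (p k) z = m * mdist (p k) y /\
    mdist z y <= (1 - m) * mdist (p k) y + de.
  by move=> k; exact: (length_space_between (p k) y LM (ltW m0) m1 de0).
have tri k := metric_triangle x (p k) y.
have pk_ge k : (k < n)%N -> d / 2 <= mdist (p k) y.
  by move=> kn; have := tri k; rewrite (pP k kn).1 -/d; have := la1 k kn; nra.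
have pk_le k : (k < n)%N -> mdist (p k) y <= 2 * d.
  by move=> kn; have := (pP k kn).2; have := la0 k; nra.
exists p, q; split.
  move=> k kn; have [qk1 qk2] := qP k; have [pk1 pk2] := pP k kn.
  have Dge := pk_ge _ kn.
  split; first by rewrite -mdist_gt0 qk1 mulr_gt0//; lra.
  rewrite qk1; have g1 := lip0_ub g x (p k).
  have g2 := lip0_ub g (q k) y.
  rewrite -/N pk1 in g1; rewrite -/N in g2.
  set D := mdist (p k) y in qk2 Dge pk2 *.
  have Nq : N * mdist (q k) y <= N * ((1 - m) * D + de) by rewrite ler_pM2l.
  have ND : N * D <= N * ((1 - la k) * d + de) by rewrite ler_pM2l.
  have emD : e * m * (d / 2) <= e * m * D by rewrite ler_pM2l// mulr_gt0.
  have thd : 6 * (th * d) = e * m * d by rewrite /th; field.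
  lra.
suff lt_absurd j k w : (j < k)%N -> (k < n)%N ->
    mdist (q j) w < 2 * mdist (p j) (q j) / e ->
    mdist (q k) w < 2 * mdist (p k) (q k) / e -> False.
  move=> j k w jn kn jw kw; have [jk|kj|//] := ltngtP j k.
    by case: (lt_absurd j k w).
  by case: (lt_absurd k j w).
move=> jk kn; have jn := ltn_trans jk kn.
have small i : (i < n)%N -> mdist (p i) (q i) <= d / (12 * n') /\
    2 * mdist (p i) (q i) / e <= d / (6 * n').
  move=> i_n; rewrite (qP i).1.
  have mD : m * mdist (p i) y <= m * (2 * d) by rewrite ler_pM2l// pk_le.
  have m2 : m * (2 * d) = e * (d / (12 * n')).
    by rewrite /m; field; rewrite gt_eqF.
  have dn0 : 0 < d / (12 * n') by rewrite divr_gt0// mulr_gt0.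
  split.
    by apply: (le_trans mD); rewrite m2; exact: ler_piMl (ltW dn0) e1.
  rewrite ler_pdivrMr//.
  suff : d / (6 * n') * e = 2 * (m * (2 * d)) by move=> ->; rewrite ler_pM2l.
  by rewrite m2; field; rewrite gt_eqF.
have [tj rj] := small _ jn; have [tk rk] := small _ kn.
move=> jw kw.
(* The path p_j, q_j, w, q_k, p_k is shorter than 2 (d / (12 n') + d / (6 n')) = d / (2 n'), the
   least gap between d(x, p_j) and d(x, p_k). *)
have := (pP j jn).1; have := (pP k kn).1.
have := metric_triangle x (p j) (p k).
have := metric_triangle (p j) (q j) (p k).
have := metric_triangle (q j) w (p k).
have := metric_triangle w (q k) (p k).
rewrite (metric_sym w (q k)) (metric_sym (q k) (p k)).
have lajk : la j * d + d / (2 * n') <= la k * d.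
  have jk1 : (j%:R + 1 : R) <= k%:R by rewrite natr1 ler_nat.
  have -> : la j * d + d / (2 * n') = (j%:R + 1) * (d / (2 * n')).
    by rewrite /la; ring.
  have -> : la k * d = k%:R * (d / (2 * n')) by rewrite /la; ring.
  by rewrite ler_wpM2r// divr_ge0// ltW// mulr_gt0.
have : d / (12 * n') = d / n' / 12 by field; rewrite gt_eqF.
have : d / (6 * n') = d / n' / 6 by field; rewrite gt_eqF.
have : d / (2 * n') = d / n' / 2 by field; rewrite gt_eqF.
lra.
Qed.

(** Take the minimum of [f] and a cone of slope 1 + e with vertex value f p - d(p, q) at [q]. The
    cone lies above [f] at [p] and far from [q], so the change is local. Normalization at the base
    point leaves [h] constant, not zero, far away. *)
Lemma local_slope_change f (p q : M) (e : R) : `|f| <= 1 -> p != q ->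
  0 < e -> exists h, [/\ `|f + h| <= 1 + e,
    mdist p q <= (f + h) p - (f + h) q &
    forall u v, 2 * mdist p q / e <= mdist q u ->
      2 * mdist p q / e <= mdist q v -> h u = h v].
Proof.
move=> f1 pq e0; set t := mdist p q.
have t0 : 0 < t by rewrite mdist_gt0.
have flip u v : f u - f v <= mdist u v.
  by rewrite (le_trans (lip0_ub f u v))// ler_piMl// mdist_ge0.
pose c w : R := f p - t + (1 + e) * mdist q w.
pose G (w : M) : R^o := Num.min (f w) (c w).
have Glip u v : G u - G v <= (1 + e) * mdist u v.
  have fuv := flip u v.
  have euv : 0 <= e * mdist u v by rewrite mulr_ge0 ?mdist_ge0 ?ltW.
  have cuv : (1 + e) * mdist q u <= (1 + e) * mdist q v + (1 + e) * mdist u v.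
    rewrite -mulrDr ler_pM2l ?addr_gt0// (metric_sym u v).
    exact: metric_triangle.
  have cE w : c w = f p - t + (1 + e) * mdist q w by [].
  rewrite /G; have [fu|fu] := leP (f u) (c u);
    have [fv|fv] := leP (f v) (c v); move: fu fv; rewrite !cE => fu fv; lra.
have Gk u v : `|G u - G v| <= (1 + e) * mdist u v.
  by rewrite ler_norml Glip andbT lerNl opprB metric_sym Glip.
exists (lip0_of Gk - f).
rewrite addrC subrK; split.
- by apply: lip0_of_norm; rewrite addr_ge0// ltW.
- rewrite lip0_ofB.
  have -> : G p = f p.
    rewrite /G min_l// /c metric_sym -/t.
    have : 0 <= e * t by rewrite mulr_ge0 ?ltW.
    lra.
  have : G q <= f p - t by rewrite /G ge_min /c mdistxx mulr0 addr0 lexx orbT.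
  lra.
- have Gf w : 2 * t / e <= mdist q w -> G w = f w.
    rewrite ler_pdivrMr// => far; rewrite /G min_l//.
    have := flip w p; have := metric_triangle w q p.
    rewrite (metric_sym w q) (metric_sym q p) -/t => wp fwp.
    have : f w <= f p - t + (1 + e) * mdist q w by lra.
    exact.
  move=> u v /Gf Gu /Gf Gv.
  have subE w : (lip0_of Gk - f) w = lip0_of Gk w - f w by [].
  by rewrite !subE !lip0_ofE Gu Gv addrAC subrr [RHS]addrAC subrr.
Qed.

(** Only a summand whose [B k] contains [u] or [v] can differ at the two points. Disjointness leaves
    at most two, each contributing at most C d(u, v). *)
Lemma disjoint_sum_norm_le (n : nat) (h : 'I_n -> lip0 M) (s : 'I_n -> R)
    (B : 'I_n -> pred M) (C : R) : 0 <= C ->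
  (forall k, `|h k| <= C) -> (forall k, `|s k| <= 1) ->
  (forall k u v, ~~ B k u -> ~~ B k v -> h k u = h k v) ->
  (forall j k w, B j w -> B k w -> j = k) ->
  `|\sum_k s k *: h k| <= 2 * C.
Proof.
move=> C0 hC s1 hB Bdisj.
apply: lip0_norm_le => [|u v]; first by rewrite mulr_ge0.
have sumE w : (\sum_k s k *: h k) w = \sum_k s k * h k w.
  have evD f g : (f + g) w = f w + g w by [].
  by rewrite (big_morph (fun g : lip0 M => g w) evD (erefl _)).
have card_le1 w : \sum_k ((B k w)%:R : R) <= 1.
  have [[k Bk]|noB] := pselect (exists k, B k w).
    rewrite (bigD1 k)//= Bk big1 ?addr0// => j jk.
    by case Bj : (B j w) => //; rewrite (Bdisj j k w) ?eqxx in jk.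
  rewrite big1 // => k _; case Bk : (B k w) => //.
  by case: noB; exists k.
have Cd0 : 0 <= C * mdist u v by rewrite mulr_ge0 ?mdist_ge0.
have term k : s k * h k u - s k * h k v <=
    (C * mdist u v) * ((B k u)%:R + (B k v)%:R).
  have : s k * h k u - s k * h k v <= C * mdist u v.
    rewrite -mulrBr (le_trans (ler_norm _))// normrM -[leRHS]mul1r.
    apply: ler_pM => //; apply: le_trans (lip_norm_ub (h k) u v) _.
    by rewrite ler_wpM2r// ?mdist_ge0// hC.
  case Bu : (B k u); case Bv : (B k v) => /= bound.
  - by rewrite (le_trans bound)// ler_peMr// lerDl.
  - by rewrite addr0 mulr1.
  - by rewrite add0r mulr1.
  - by rewrite (hB k u v) ?Bu ?Bv// subrr addr0 mulr0.
rewrite !sumE -sumrB.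
apply: le_trans; first by apply: ler_sum => k _; exact: term.
rewrite -mulr_sumr big_split/=.
have := card_le1 u; have := card_le1 v; nra.
Qed.

(** The values T h_k are multiples a_k y of one vector; with the signs of the a_k as coefficients
    their norms add up without cancellation. *)
Lemma rank_one_sum_norm (X : normedModType R) (T : boundedOp X X) (n : nat)
    (h : 'I_n -> X) (C : R) : rank_one T ->
  (forall s : 'I_n -> R, (forall k, `|s k| <= 1) ->
     `|\sum_k s k *: h k| <= C) ->
  \sum_k `|T (h k)| <= `|T| * C.
Proof.
move=> [y y0 Ty] hC.
have /choice[a aP] : forall k, exists a, T (h k) = a *: y.
  move=> k; have : range T (T (h k)) by exists (h k).
  by rewrite Ty => -[a _ <-]; exists a.
have s1 k : `|Num.sg (a k)| <= 1.
  by rewrite normr_sg; case: (_ != _); rewrite ?ler01 ?lexx.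
have := op_norm_ub T (\sum_k Num.sg (a k) *: h k).
rewrite linear_sum => TS.
have E : \sum_k T (Num.sg (a k) *: h k) = (\sum_k `|a k|) *: y.
  rewrite scaler_suml; apply: eq_bigr => k _.
  have -> : T (Num.sg (a k) *: h k) = Num.sg (a k) *: T (h k) by exact: linearZ.
  by rewrite aP scalerA -normrEsg.
have -> : \sum_k `|T (h k)| = `|(\sum_k `|a k|) *: y|.
  rewrite normrZ ger0_norm ?sumr_ge0// mulr_suml.
  by apply: eq_bigr => k _; rewrite aP normrZ.
rewrite -E (le_trans TS)//; exact: (ler_wpM2l (op_norm_ge0 T) (hC _ s1)).
Qed.

Lemma length_space_lip0_daugavet : length_space M -> daugavet_property (lip0 M).
Proof.
move=> LM T T1; set tau := `|T|.
apply/eqP; rewrite eq_le; apply/andP; split.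
  rewrite (le_trans (ler_normD _ _))// addrC lerD2r.
  by apply: op_norm_le => // f; rewrite mul1r.
have tau0 : 0 < tau.
  rewrite normr_gt0; apply/eqP => T0; have [y y0 Ty] := T1.
  have [f _ fE] : range T y by rewrite Ty; exists 1; rewrite ?scale1r.
  by rewrite -fE T0 eqxx in y0.
(* The error collects 3 e from the slopes and e (1 + tau) from the norm 1 + e of the test function.
   The bound 2 e <= tau ensures e <= |T f0|. *)
suff approx e : 0 < e -> e <= 1 -> 2 * e <= tau ->
    1 + tau <= `|T + id_op (lip0 M)| + (4 + tau) * e.
  apply/ler_addgt0Pr => c c0.
  pose e := Num.min (Num.min 1 (tau / 2)) (c / (4 + tau)).
  have c40 : 0 < 4 + tau by rewrite addr_gt0.
  have e0 : 0 < e by rewrite !lt_min ltr01 !divr_gt0.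
  have := approx e e0.
  have ec : e <= c / (4 + tau) by rewrite ge_min lexx orbT.
  have e1 : e <= 1 by rewrite !ge_min lexx.
  have e2 : e <= tau / 2 by rewrite !ge_min lexx orbT.
  rewrite ler_pdivlMr// in ec; rewrite ler_pdivlMr// in e2.
  rewrite e1 mulrC e2 => /(_ isT isT) /le_trans; apply.
  by rewrite lerD2l mulrC.
move=> e0 e1 e2tau.
have taue : tau - e < `|T| by rewrite gtrBl.
have [f0 f01 gtau] := op_norm_gtP taue.
set g := T f0 in gtau.
have eg : e <= `|g| by lra.
(* With n e > 6 tau, the values |T h_k|, whose sum is at most 6 tau, cannot all exceed [e]. *)
pose n := (Num.truncn (tau * 6 / e)).+1.
have [p [q [pqP qdisj]]] := length_space_small_pairs n LM e0 e1 eg.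
have /choice[h hP] : forall k : 'I_n, exists h, [/\ `|f0 + h| <= 1 + e,
    mdist (p k) (q k) <= (f0 + h) (p k) - (f0 + h) (q k) &
    forall u v, 2 * mdist (p k) (q k) / e <= mdist (q k) u ->
      2 * mdist (p k) (q k) / e <= mdist (q k) v -> h u = h v].
  by move=> k; apply: local_slope_change => //; exact: (pqP _ (ltn_ord k)).1.
pose B (k : 'I_n) : pred M :=
  fun w => mdist (q k) w < 2 * mdist (p k) (q k) / e.
have h3 k : `|h k| <= 3.
  have [fh _ _] := hP k.
  have -> : h k = (f0 + h k) - f0 by rewrite addrC addKr.
  rewrite (le_trans (ler_normB _ _))//; lra.
have hsum (s : 'I_n -> R) : (forall k, `|s k| <= 1) ->
    `|\sum_k s k *: h k| <= 2 * 3.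
  move=> s1; apply: (disjoint_sum_norm_le (B := B)) => //.
    by move=> k u v; rewrite /B -!leNgt; have [_ _] := hP k; exact.
  move=> j k w Bj Bk; apply/val_inj.
  exact: (qdisj j k w (ltn_ord j) (ltn_ord k) Bj Bk).
have [k Thk] : exists k, `|T (h k)| <= e.
  apply: contrapT => /forallNP big.
  have := rank_one_sum_norm T1 hsum; rewrite leNgt => /negP; apply.
  apply: (@lt_le_trans _ _ (\sum_(k < n) e)).
    rewrite sumr_const card_ord -[_ *+ n]mulr_natl.
    have -> : `|T| * (2 * 3) = tau * 6 by rewrite /tau; ring.
    by rewrite -ltr_pdivrMr// truncnS_gt.
  by apply: ler_sum => k _; rewrite ltW// ltNge; apply/negP; exact: big.
have [fh slope_f _] := hP k; have [pq slope_g] := pqP _ (ltn_ord k).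
have t0 : 0 < mdist (p k) (q k) by rewrite mdist_gt0.
set t := mdist _ _ in slope_f slope_g t0.
have TI : (T + id_op (lip0 M)) (f0 + h k) = g + T (h k) + (f0 + h k).
  by rewrite bopDE linearD.
have slope_Th := lip0_ub (T (h k)) (q k) (p k).
have Th_t : `|T (h k)| * mdist (q k) (p k) <= e * t.
  by rewrite metric_sym ler_pM2r.
(* At (p_k, q_k) the slope is at least |g| - e from [g], -e from T h_k and 1 from f0 + h_k. *)
have lower : (1 + `|g| - 2 * e) * t <=
    `|(T + id_op (lip0 M)) (f0 + h k)| * t.
  apply: le_trans (lip0_ub _ (p k) (q k)); rewrite TI.
  rewrite [X in _ <= X - _]lip0DE [X in _ <= _ - X]lip0DE.
  rewrite [X in _ <= X + _ - _]lip0DE [X in _ <= _ - (X + _)]lip0DE.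
  have lin (a b c d a' b' c' : R) : (`|g| - e) * t <= a - a' ->
      b' - b <= d -> d <= e * t -> t <= c - c' ->
      (1 + `|g| - 2 * e) * t <= a + b + c - (a' + b' + c') by lra.
  exact: lin slope_g slope_Th Th_t slope_f.
rewrite ler_pM2r// in lower.
have upper : `|(T + id_op (lip0 M)) (f0 + h k)| <=
    `|T + id_op (lip0 M)| * (1 + e).
  apply: le_trans (op_norm_ub _ _) _.
  exact: (ler_wpM2l (op_norm_ge0 _) fh).
have sub : `|T + id_op (lip0 M)| <= tau + 1.
  rewrite (le_trans (ler_normD _ _))// lerD2l.
  by apply: op_norm_le => // f; rewrite mul1r.
have : e * `|T + id_op (lip0 M)| <= e * (tau + 1) by rewrite ler_pM2l.
lra.
Qed.

End lip0_length.

Theorem theorem3p3 (R : realType) (M : completeMetricType R) :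
  [<-> length_space M;
       daugavet_property (lip0 M);
       daugavet_property (free_space M)].
Proof.
tfae.
- exact: length_space_lip0_daugavet.
- exact: lip0_daugavet_free.
- by move=> /free_daugavet_approx_midpoints /approx_midpoints_length_space.
Qed.
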